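(* Let $\mathbb{Q}^{iaz}$ be the initial algebra among all algebras over the signature $\Sigma_{iamdz}=\{0,1,+,\cdot,{}^{-1}\}$ that satisfy the axioms $E_{iamdz}$ of inversive arithmetical meadows with zero together with the equation $$(1+x^2+y^2)\cdot(1+x^2+y^2)^{-1}=1 .$$ Then $\mathbb{Q}^{iaz}$ is (up to isomorphism) the subalgebra of the $\Sigma_{iamdz}$-reduct of $\mathbb{Q}_0^{i}$ whose domain is the set of all non-negative rational numbers, where $\mathbb{Q}_0^{i}$ is the inversive meadow of rational numbers.
   Context: $E_{iamdz}$ consists of the equations (universally quantified) $(x+y)+z=x+(y+z)$, $x+y=y+x$, $x+0=x$, $(x\cdot y)\cdot z=x\cdot(y\cdot z)$, $x\cdot y=y\cdot x$, $x\cdot 1=x$, $x\cdot(y+z)=x\cdot y+x\cdot z$, $(x^{-1})^{-1}=x$, and $x\cdot(x\cdot x^{-1})=x$. Here $0,1$ are constants, $+,\cdot$ are binary and ${}^{-1}$ is unary; $p^2$ abbreviates $p\cdot p$. (There is no additive inverse, and $0\cdot x=0$ is not among the axioms.) The initial algebra of a set of equations $E$ over $\Sigma$ is the initial object in the class of all $\Sigma$-algebras satisfying $E$, equivalently the closed $\Sigma$-terms modulo provable equality from $E$; it is determined up to isomorphism. $\mathbb{Q}_0^{i}$ is the zero-totalized field of rational numbers: the algebra over $\{0,1,+,\cdot,-,{}^{-1}\}$ that is the field of rational numbers with $q^{-1}$ the usual inverse for $q\neq 0$ and $0^{-1}=0$. The $\Sigma_{iamdz}$-reduct is obtained by forgetting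 $-$. *)

(* Defs.v *)
From HB Require Import structures.
From mathcomp Require Import all_boot all_order all_algebra.
From mathcomp Require Import boolp.

Set Implicit Arguments.
Unset Strict Implicit.
Unset Printing Implicit Defensive.

Import Order.TTheory GRing.Theory Num.Theory.

(* Algebras over the signature {0, 1, +, *, inverse}; no equation is imposed. *)
Record alg := Alg {
  carrier :> Type;
  zero : carrier;
  one : carrier;
  add : carrier -> carrier -> carrier;
  mul : carrier -> carrier -> carrier;
  inv : carrier -> carrier }.

Record hom (A B : alg) (f : A -> B) : Prop := Hom {
  hom_zero : f (zero A) = zero B;
  hom_one : f (one A) = one B;
  hom_add : forall x y, f (add x y) = add (f x) (f y);
  hom_mul : forall x y, f (mul x y) = mul (f x) (f y);
  hom_inv : forall x, f (inv x) = inv (f x) }.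

Definition isomorphic (A B : alg) : Prop :=
  exists2 f : A -> B, hom f & bijective f.

Record subclosed (A : alg) (D : pred A) : Prop := Subclosed {
  sub_zero : D (zero A);
  sub_one : D (one A);
  sub_add : forall x y, D x -> D y -> D (add x y);
  sub_mul : forall x y, D x -> D y -> D (mul x y);
  sub_inv : forall x, D x -> D (inv x) }.

Definition subalg (A : alg) (D : pred A) (cD : subclosed D) : alg :=
  @Alg {x : A | D x}
    (exist _ (zero A) (sub_zero cD))
    (exist _ (one A) (sub_one cD))
    (fun x y => exist _ (add (sval x) (sval y))
                        (sub_add cD (svalP x) (svalP y)))
    (fun x y => exist _ (mul (sval x) (sval y))
                        (sub_mul cD (svalP x) (svalP y)))
    (fun x => exist _ (inv (sval x)) (sub_inv cD (svalP x))).

(* Terms with variables in V; the closed terms are those of type term void. *)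
Inductive term (V : Type) : Type :=
| Var of V
| Zero
| One
| Add of term V & term V
| Mul of term V & term V
| Inv of term V.

Arguments Zero {V}.
Arguments One {V}.

Fixpoint eval (V : Type) (A : alg) (v : V -> A) (t : term V) : A :=
  match t with
  | Var i => v i
  | Zero => zero A
  | One => one A
  | Add s t => add (eval v s) (eval v t)
  | Mul s t => mul (eval v s) (eval v t)
  | Inv s => inv (eval v s)
  end.

(* A set of equations: E s t means that s = t belongs to the set. *)
Definition equations := term nat -> term nat -> Prop.

Definition satisfies (A : alg) (E : equations) : Prop :=
  forall s t, E s t -> forall v : nat -> A, eval v s = eval v t.

Definition initial (E : equations) (A : alg) : Prop :=
  satisfies A E /\
  forall B : alg, satisfies B E ->
    exists2 f : A -> B, hom f & forall g : A -> B, hom g -> g =1 f.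

Declare Scope iam_scope.
Delimit Scope iam_scope with iam.
Bind Scope iam_scope with term.
Notation "0" := Zero : iam_scope.
Notation "1" := One : iam_scope.
Notation "s + t" := (Add s t) : iam_scope.
Notation "s * t" := (Mul s t) : iam_scope.
Notation "s ^-1" := (Inv s) : iam_scope.
Notation sq s := (Mul s s) (only parsing).

Section Identities.
Let x : term nat := Var 0%N.
Let y : term nat := Var 1%N.
Let z : term nat := Var 2%N.
Local Open Scope iam_scope.

Inductive E_iamdz : equations :=
| ax_addA : E_iamdz ((x + y) + z) (x + (y + z))
| ax_addC : E_iamdz (x + y) (y + x)
| ax_add0 : E_iamdz (x + 0) x
| ax_mulA : E_iamdz ((x * y) * z) (x * (y * z))
| ax_mulC : E_iamdz (x * y) (y * x)
| ax_mul1 : E_iamdz (x * 1) x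
| ax_mulD : E_iamdz (x * (y + z)) (x * y + x * z)
| ax_invK : E_iamdz (x^-1)^-1 x
| ax_ril : E_iamdz (x * (x * x^-1)) x.

Inductive E_iaz : equations :=
| ax_iamdz s t of E_iamdz s t : E_iaz s t
| ax_sumsq : E_iaz ((1 + sq x + sq y) * (1 + sq x + sq y)^-1) 1.
End Identities.

(* Every set of equations has an initial algebra: closed terms modulo provable
   equality. *)
Section InitialExists.
Variable E : equations.

Notation closed := (term void).

Definition term_alg : alg := @Alg closed Zero One (@Add _) (@Mul _) (@Inv _).

(* Evaluation in term_alg is substitution. *)
Inductive provable : closed -> closed -> Prop :=
| prov_ax s t (v : nat -> term_alg) of E s t : provable (eval v s) (eval v t)
| prov_refl s : provable s s
| prov_sym s t of provable s t : provable t s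
| prov_trans s t u of provable s t & provable t u : provable s u
| prov_add s s' t t' of provable s s' & provable t t' :
    provable (Add s t) (Add s' t')
| prov_mul s s' t t' of provable s s' & provable t t' :
    provable (Mul s t) (Mul s' t')
| prov_inv s s' of provable s s' : provable (Inv s) (Inv s').

Definition qterm : Type := {C : closed -> Prop | exists t, C = provable t}.

Definition class (t : closed) : qterm :=
  exist _ (provable t) (ex_intro _ t erefl).

Definition repr (C : qterm) : closed := sval (cid (svalP C)).

Definition initial_alg : alg :=
  @Alg qterm (class Zero) (class One)
    (fun C D => class (Add (repr C) (repr D)))
    (fun C D => class (Mul (repr C) (repr D)))
    (fun C => class (Inv (repr C))).

Lemma qterm_eq (C D : qterm) : sval C = sval D -> C = D.
Proof.
case: C D => [C hC] [D hD] /= CD; case: D / CD hD => hD.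
by congr exist; apply: Prop_irrelevance.
Qed.

Lemma class_eq s t : provable s t -> class s = class t.
Proof.
move=> st; apply: qterm_eq => /=; apply: funext => u; apply: propext.
by split=> [su|tu]; [apply: prov_trans (prov_sym st) su | apply: prov_trans st tu].
Qed.

Lemma reprK C : class (repr C) = C.
Proof.
apply: qterm_eq => /=; rewrite /repr; case: cid => t /= ->; by [].
Qed.

Lemma repr_class t : provable (repr (class t)) t.
Proof. by have /(congr1 sval) /= -> := reprK (class t); apply: prov_refl. Qed.

Lemma eval_class (v : nat -> initial_alg) s :
  eval v s = class (eval (fun i => repr (v i) : term_alg) s).
Proof.
elim: s => /= [i|||s -> t ->|s -> t ->|s ->] //; first by rewrite reprK.
- by apply: class_eq; apply: prov_add; apply: repr_class.
- by apply: class_eq; apply: prov_mul; apply: repr_class.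
- by apply: class_eq; apply: prov_inv; apply: repr_class.
Qed.

Lemma eval_subst (B : alg) (w : void -> B) (v : nat -> term_alg) s :
  eval w (eval v s) = eval (fun i => eval w (v i)) s.
Proof. by elim: s => //= [s -> t ->|s -> t ->|s ->]. Qed.

Lemma provable_sound (B : alg) (w : void -> B) s t :
  satisfies B E -> provable s t -> eval w s = eval w t.
Proof.
move=> BE; elim=> {s t} //=.
- by move=> s t v st; rewrite !eval_subst; apply: BE.
- by move=> s t u _ -> _ ->.
- by move=> s s' t t' _ -> _ ->.
- by move=> s s' t t' _ -> _ ->.
- by move=> s s' _ ->.
Qed.

Lemma initial_algP : initial E initial_alg.
Proof.
split=> [s t st v|B BE].
  by rewrite !eval_class; apply: class_eq; apply: prov_ax.
pose w : void -> B := fun x => match x with end.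
have evalR t : eval w (repr (class t)) = eval w t.
  exact: provable_sound BE (repr_class t).
exists (fun C : initial_alg => eval w (repr C)).
  by split=> [||x y|x y|x]; rewrite evalR.
move=> g [g0 g1 gD gM gV].
suff gE t : g (class t) = eval w t by move=> C; rewrite -{1}(reprK C) gE.
elim: t => /= [[]|||s <- t <-|s <- t <-|s <-] //.
- rewrite -gD /=; congr g; apply/esym/class_eq.
  by apply: prov_add; apply: repr_class.
- rewrite -gM /=; congr g; apply/esym/class_eq.
  by apply: prov_mul; apply: repr_class.
- rewrite -gV /=; congr g; apply/esym/class_eq.
  by apply: prov_inv; apply: repr_class.
Qed.
End InitialExists.

(* Algebras over the signature {0, 1, +, *, -, inverse}. *)
Record malg := MAlg {
  mcarrier : Type;
  mzero : mcarrier;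
  mone : mcarrier;
  madd : mcarrier -> mcarrier -> mcarrier;
  mmul : mcarrier -> mcarrier -> mcarrier;
  mopp : mcarrier -> mcarrier;
  minv : mcarrier -> mcarrier }.

Definition reduct (M : malg) : alg :=
  @Alg (mcarrier M) (mzero M) (mone M) (@madd M) (@mmul M) (@minv M).

(* The inverse of the field rat is already zero-totalized: 0^-1 = 0 (invr0). *)
Definition rat0 : malg :=
  @MAlg rat 0%R 1%R +%R *%R (fun q => - q)%R GRing.inv.

Definition nonneg : pred (reduct rat0) := fun q : rat => (0 <= q)%R.

Lemma nonneg_closed : subclosed nonneg.
Proof.
split; rewrite /nonneg /=.
- exact: lexx.
- exact: ler01.
- by move=> x y; apply: addr_ge0.
- by move=> x y; apply: mulr_ge0.
- by move=> x; rewrite invr_ge0.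
Qed.

(* Main.v *)
From mathcomp Require Import all_boot all_order all_algebra.
From mathcomp Require Import ring.
Require Import Defs.

Set Implicit Arguments.
Unset Strict Implicit.
Unset Printing Implicit Defensive.

Import Order.TTheory GRing.Theory Num.Theory.

(* Sending n/m to the numeral quotient n m^-1 is a homomorphism from the
   non-negative rationals to A provided every positive numeral is invertible in
   A; by initiality it is inverse to the homomorphism in the other direction.
   Invertibility reduces to prime numerals p, and -1 is a sum of two squares
   modulo p, so p divides some 1 + a^2 + b^2, which is invertible in A.
   Annihilation by 0 is not an axiom, but holds for numerals, and
   0^-1 = 0 is derivable. *)

(** * Sums of two squares in finite fields *)

Section FiniteField.
Variable F : finFieldType.
Local Open Scope ring_scope.

(* Only 0 has a single square root. *)
Lemma card_squares : (#|F| < #|[set x ^+ 2 | x : F]| * 2)%N.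
Proof.
set S := [set _ | x : F].
have S0 : 0 \in S by apply/imsetP; exists 0; rewrite ?expr0n.
(* [F] is counted by the fibres of squaring. *)
have -> : #|F| = (\sum_(s in S) #|[set x : F | x ^+ 2 == s]|)%N.
  rewrite -sum1_card (partition_big (fun x : F => x ^+ 2) (mem S)) /=; last first.
    by move=> x _; apply: imset_f.
  by apply: eq_bigr => s _; rewrite -sum1_card; apply: eq_bigl => x; rewrite inE.
have root2 s : (#|[set x : F | x ^+ 2 == s]| <= 2)%N.
  have [->|[y]] := set_0Vmem [set x : F | x ^+ 2 == s]; first by rewrite cards0.
  rewrite inE => /eqP <-; apply: leq_trans (_ : #|[set y; - y]| <= 2)%N.
    by apply/subset_leq_card/subsetP => x; rewrite !inE eqf_sqr.
  by rewrite cards2; case: (_ != _).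
rewrite -sum_nat_const (bigD1 0) //= [X in (_ < X)%N](bigD1 0) //=.
(* Strictness comes from the fibre over 0, which lies in a singleton. *)
rewrite -addSn leq_add ?leq_sum // ltnS -(cards1 (0 : F)).
by apply/subset_leq_card/subsetP => x; rewrite !inE expf_eq0.
Qed.

(** Pigeonhole: the squares and their images under s -> -1 - s each fill more than half of [F], so
    they share an element. *)
Lemma finfield_sumsq : exists a b : F, 1 + a ^+ 2 + b ^+ 2 = 0.
Proof.
set S := [set x ^+ 2 | x : F]; set T := [set - 1 - s | s in S].
have cT : #|T| = #|S| by apply: card_imset => x y /addrI /oppr_inj.
have : S :&: T != set0.
  apply/eqP => ST; have := card_squares; rewrite -/S muln2 -addnn -{2}cT.
  by rewrite -cardsUI ST cards0 addn0 ltnNge max_card.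
case/set0Pn => s /setIP[/imsetP[a _ ->] /imsetP[_ /imsetP[b _ ->] e]].
by exists a, b; rewrite e; ring.
Qed.
End FiniteField.

Lemma prime_dvd_sumsq p : prime p -> exists a b : nat, p %| 1 + a ^ 2 + b ^ 2.
Proof.
move=> pp; have [a [b ab]] := finfield_sumsq 'F_p.
(* The witnesses are the natural representatives of [a] and [b], which [natr_Zp] casts back to
   'F_p. *)
exists a, b; rewrite (dvdn_pcharf (pchar_Fp pp)) !natrD !natrX !natr_Zp.
exact/eqP.
Qed.

(** * Equational consequences and units in a model *)

Section Numerals.
Variables (A : alg) (AE : satisfies A E_iaz).

(** Valuation of the three variables of the axioms; variable 2 gets [z] as the default of [nth]. *)
Let val3 (x y z : A) (i : nat) : A := nth z [:: x; y] i.

Lemma alg_addA (x y z : A) : add (add x y) z = add x (add y z).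
Proof. exact: (AE (ax_iamdz ax_addA) (val3 x y z)). Qed.
Lemma alg_addC (x y : A) : add x y = add y x.
Proof. exact: (AE (ax_iamdz ax_addC) (val3 x y x)). Qed.
Lemma alg_addr0 (x : A) : add x (zero A) = x.
Proof. exact: (AE (ax_iamdz ax_add0) (val3 x x x)). Qed.
Lemma alg_mulA (x y z : A) : mul (mul x y) z = mul x (mul y z).
Proof. exact: (AE (ax_iamdz ax_mulA) (val3 x y z)). Qed.
Lemma alg_mulC (x y : A) : mul x y = mul y x.
Proof. exact: (AE (ax_iamdz ax_mulC) (val3 x y x)). Qed.
Lemma alg_mulr1 (x : A) : mul x (one A) = x.
Proof. exact: (AE (ax_iamdz ax_mul1) (val3 x x x)). Qed.
Lemma alg_mulDr (x y z : A) : mul x (add y z) = add (mul x y) (mul x z).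
Proof. exact: (AE (ax_iamdz ax_mulD) (val3 x y z)). Qed.
Lemma alg_invK (x : A) : inv (inv x) = x.
Proof. exact: (AE (ax_iamdz ax_invK) (val3 x x x)). Qed.
Lemma alg_ril (x : A) : mul x (mul x (inv x)) = x.
Proof. exact: (AE (ax_iamdz ax_ril) (val3 x x x)). Qed.
Lemma alg_sumsq (x y : A) :
  let s := add (add (one A) (mul x x)) (mul y y) in mul s (inv s) = one A.
Proof. exact: (AE ax_sumsq (val3 x y x)). Qed.

Lemma alg_add0r (x : A) : add (zero A) x = x.
Proof. by rewrite alg_addC alg_addr0. Qed.
Lemma alg_mul1r (x : A) : mul (one A) x = x.
Proof. by rewrite alg_mulC alg_mulr1. Qed.
Lemma alg_mulDl (x y z : A) : mul (add x y) z = add (mul x z) (mul y z).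
Proof. by rewrite alg_mulC alg_mulDr !(alg_mulC z). Qed.
Lemma alg_mulAC (x y z : A) : mul (mul x y) z = mul (mul x z) y.
Proof. by rewrite !alg_mulA (alg_mulC y). Qed.
Lemma alg_mulACA (x y z t : A) :
  mul (mul x y) (mul z t) = mul (mul x z) (mul y t).
Proof. by rewrite -!alg_mulA (alg_mulAC x). Qed.

(** Distribute 0 * (0 + 1) = 0 * 1. *)
Lemma alg_mul00 : mul (zero A) (zero A) = zero A.
Proof.
have := congr1 (mul (zero A)) (alg_add0r (one A)).
by rewrite alg_mulDr alg_mulr1 alg_addr0.
Qed.

(** First 0 * 0^-1 = (0 * 0) * 0^-1 = 0 * (0 * 0^-1) = 0; then [alg_ril] at 0^-1, with [alg_invK],
    collapses 0^-1 to 0. *)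
Lemma alg_inv0 : inv (zero A) = zero A.
Proof.
have e : mul (zero A) (inv (zero A)) = zero A.
  by rewrite -[RHS]alg_ril -alg_mulA alg_mul00.
by rewrite -[LHS]alg_ril alg_invK (alg_mulC _ (zero A)) e alg_mulC.
Qed.

Definition unit_elt (x : A) := mul x (inv x) = one A.

(** x * x^-1 = (x * x^-1) * (x * y) = (x * (x * x^-1)) * y = x * y = 1. *)
Lemma unit_of_mul (x y : A) : mul x y = one A -> unit_elt x.
Proof.
move=> xy; rewrite /unit_elt -[LHS]alg_mulr1 -{1}xy -alg_mulA.
by rewrite (alg_mulC _ x) alg_ril.
Qed.

Lemma unit_dvd (x y : A) : unit_elt (mul x y) -> unit_elt x.
Proof. by rewrite /unit_elt alg_mulA => /unit_of_mul. Qed.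

Lemma unit_mul (x y : A) : unit_elt x -> unit_elt y -> unit_elt (mul x y).
Proof.
move=> ux uy; apply: (@unit_of_mul _ (mul (inv x) (inv y))).
by rewrite alg_mulACA ux uy alg_mulr1.
Qed.

Lemma unit_mulI (w x y : A) : unit_elt w -> mul x w = mul y w -> x = y.
Proof.
move=> uw e; rewrite -[x]alg_mulr1 -[y]alg_mulr1 -uw -!alg_mulA.
by rewrite e.
Qed.

(** * Invertibility of positive numerals *)

Fixpoint numeral (n : nat) : A :=
  if n is n'.+1 then add (numeral n') (one A) else zero A.

Lemma numeral1 : numeral 1 = one A.
Proof. exact: alg_add0r. Qed.

Lemma numeralD m n : numeral (m + n) = add (numeral m) (numeral n).
Proof.
elim: n => [|n IH]; first by rewrite addn0 alg_addr0.
by rewrite addnS /= IH alg_addA.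
Qed.

(** Stands in for annihilation by 0 in the base case of [numeralM]. *)
Lemma numeral_mul0 n : mul (numeral n) (zero A) = zero A.
Proof.
elim: n => [|n IH] /=; first exact: alg_mul00.
by rewrite alg_mulDl IH alg_mul1r alg_addr0.
Qed.

Lemma numeralM m n : numeral (m * n) = mul (numeral m) (numeral n).
Proof.
elim: n => [|n IH]; first by rewrite muln0 numeral_mul0.
by rewrite mulnSr numeralD IH /= alg_mulDr alg_mulr1.
Qed.

Lemma numeral_prime_unit p : prime p -> unit_elt (numeral p).
Proof.
move=> /prime_dvd_sumsq[a [b /dvdnP[k e]]].
apply: (@unit_dvd _ (numeral k)); rewrite -numeralM mulnC -e !numeralD.
by rewrite numeral1 !numeralM; apply: alg_sumsq.
Qed.

(** Strong induction: split off the prime [pdiv n], leaving a smaller cofactor. *)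
Lemma numeral_unit n : 0 < n -> unit_elt (numeral n).
Proof.
elim/ltn_ind: n => n IH n0.
have [n1|n1] := leqP n 1.
  have -> : n = 1 by apply/eqP; rewrite eqn_leq n1.
  by apply: (@unit_of_mul _ (one A)); rewrite numeral1 alg_mulr1.
have pp := pdiv_prime n1; have /dvdnP[k e] := pdiv_dvd n.
have k0 : 0 < k by move: n0; rewrite e muln_gt0 => /andP[].
rewrite e numeralM; apply: unit_mul; last exact: numeral_prime_unit.
by apply: IH => //; rewrite [X in _ < X]e ltn_Pmulr // prime_gt1.
Qed.

(** * The homomorphism from the non-negative rationals to a model *)

(** Total on [rat]: the absolute value drops the sign of the numerator, so the value represents [q]
    only for [q] non-negative. *)
Definition of_rat (q : rat) : A :=
  mul (numeral `|numq q|) (inv (numeral `|denq q|)).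

Lemma of_rat_den q :
  mul (of_rat q) (numeral `|denq q|) = numeral `|numq q|.
Proof.
rewrite alg_mulA (alg_mulC (inv _)) numeral_unit ?alg_mulr1 //.
by rewrite absz_gt0 denq_neq0.
Qed.

Lemma nonneg_ratE (q : rat) : (0 <= q)%R ->
  (q * `|denq q|%N%:R = `|numq q|%N%:R)%R.
Proof.
move=> q0; rewrite !pmulrn absz_denq gez0_abs ?numq_ge0 //.
by rewrite -{1}(divq_num_den q) divfK // intr_eq0 denq_neq0.
Qed.

(** Lets the homomorphism laws be checked on unreduced fractions: since positive numerals can be
    cancelled, any equation x * m = n with m > 0 determines [x]. *)
Lemma of_ratP q m n (x : A) : (0 <= q)%R -> 0 < m ->
  (q * m%:R = n%:R)%R -> mul x (numeral m) = numeral n -> x = of_rat q.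
Proof.
move=> q0 m0 qm xm.
have d0 : 0 < `|denq q| by rewrite absz_gt0 denq_neq0.
(* Cross-multiplication in [nat], checked after casting to [rat]. *)
have e : n * `|denq q| = `|numq q| * m.
  apply/eqP; rewrite -(eqr_nat rat) !natrM -qm -nonneg_ratE //.
  by apply/eqP; ring.
apply: (unit_mulI (unit_mul (numeral_unit m0) (numeral_unit d0))).
rewrite -alg_mulA xm (alg_mulC (numeral m)) -alg_mulA of_rat_den.
by rewrite -!numeralM e.
Qed.

Lemma of_rat_nat n : of_rat n%:R%R = numeral n.
Proof.
apply/esym/(@of_ratP _ 1 n); rewrite ?ler0n ?mulr1 //.
by rewrite numeral1 alg_mulr1.
Qed.

Lemma of_ratD p q : (0 <= p)%R -> (0 <= q)%R ->
  of_rat (p + q)%R = add (of_rat p) (of_rat q).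
Proof.
move=> p0 q0; apply/esym.
apply: (@of_ratP _ (`|denq p| * `|denq q|)
  (`|numq p| * `|denq q| + `|numq q| * `|denq p|)).
- exact: addr_ge0.
- by rewrite muln_gt0 !absz_gt0 !denq_neq0.
- rewrite natrD !natrM -!nonneg_ratE //; ring.
- rewrite numeralD !numeralM -!of_rat_den alg_mulDl -!alg_mulA.
  by rewrite [X in add _ X]alg_mulAC.
Qed.

Lemma of_ratM p q : (0 <= p)%R -> (0 <= q)%R ->
  of_rat (p * q)%R = mul (of_rat p) (of_rat q).
Proof.
move=> p0 q0; apply/esym.
apply: (@of_ratP _ (`|denq p| * `|denq q|) (`|numq p| * `|numq q|)).
- exact: mulr_ge0.
- by rewrite muln_gt0 !absz_gt0 !denq_neq0.
- rewrite !natrM -!nonneg_ratE //; ring.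
- by rewrite !numeralM -!of_rat_den alg_mulACA.
Qed.

Lemma of_ratV q : (0 <= q)%R -> of_rat q^-1%R = inv (of_rat q).
Proof.
(* At 0 the numerator gives no unit, so the derived 0^-1 = 0 is used. *)
move=> q0; have [->|qn0] := eqVneq q 0%R.
  by rewrite invr0 (of_rat_nat 0) alg_inv0.
have n0 : 0 < `|numq q| by rewrite absz_gt0 numq_eq0.
apply/esym/(@of_ratP _ `|numq q| `|denq q|) => //.
- by rewrite invr_ge0.
- by rewrite -nonneg_ratE // mulKf.
rewrite -of_rat_den -alg_mulA (alg_mulC (inv _)).
rewrite [mul _ (inv _)](_ : _ = one A) ?alg_mul1r //.
(* [of_rat q] is a unit because it divides the numeral of its nonzero numerator. *)
by apply: (@unit_dvd _ (numeral `|denq q|)); rewrite of_rat_den; apply: numeral_unit.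
Qed.

Lemma of_rat_hom :
  hom (fun x : subalg nonneg_closed => of_rat (sval x)).
Proof.
split=> [||[p p0] [q q0]|[p p0] [q q0]|[q q0]] /=.
- exact: (of_rat_nat 0).
- by rewrite (of_rat_nat 1) numeral1.
- exact: of_ratD.
- exact: of_ratM.
- exact: of_ratV.
Qed.

Lemma hom_numeral (f : A -> subalg nonneg_closed) n :
  hom f -> sval (f (numeral n)) = n%:R%R :> rat.
Proof.
move=> [f0 f1 fD _ _]; elim: n => [|n IH] /=; first by rewrite f0.
by rewrite fD f1 /= IH -natr1.
Qed.

(** Multiplied by the nonzero denominator, both sides become the numerator, because [f] sends
    numerals to natural numbers. *)
Lemma hom_of_rat (f : A -> subalg nonneg_closed) (q : rat) :
  hom f -> (0 <= q)%R -> sval (f (of_rat q)) = q.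
Proof.
move=> hf q0; have d0 : (`|denq q|%N%:R != 0 :> rat)%R.
  by rewrite pnatr_eq0 -lt0n absz_gt0 denq_neq0.
apply: (mulIf d0); rewrite nonneg_ratE // -!(hom_numeral _ hf).
by rewrite -of_rat_den (hom_mul hf).
Qed.
End Numerals.

(** * The rational model and the isomorphism *)

Lemma nonneg_rat_sat : satisfies (subalg nonneg_closed) E_iaz.
Proof.
have ril (x : rat) : (x * (x * x^-1) = x)%R.
  by have [->|x0] := eqVneq x 0%R; rewrite ?mul0r // mulfV ?mulr1.
move=> s t [{}s {}t []|] v; apply: val_inj => /=.
- by rewrite addrA.
- exact: addrC.
- exact: addr0.
- by rewrite mulrA.
- exact: mulrC.
- exact: mulr1.
- exact: mulrDr.
- exact: invrK.
- exact: ril.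
- apply: mulfV; apply: lt0r_neq0.
  by rewrite -!expr2 -addrA ltr_pwDl // addr_ge0 ?sqr_ge0.
Qed.

Lemma hom_id (A : alg) : hom (@id A).
Proof. by []. Qed.

Lemma hom_comp (A B C : alg) (g : B -> C) (f : A -> B) :
  hom g -> hom f -> hom (g \o f).
Proof.
move=> [g0 g1 gD gM gV] [f0 f1 fD fM fV].
by split=> *; rewrite /= ?f0 ?f1 ?fD ?fM ?fV.
Qed.

(** The identity is also a homomorphism from [A] to itself, and initiality leaves room for only
    one. *)
Lemma initial_endo (E : equations) (A : alg) (f : A -> A) :
  initial E A -> hom f -> f =1 id.
Proof.
move=> [AE init] hf x; have [i _ iU] := init A AE.
by rewrite (iU f hf) -(iU id (hom_id A)).
Qed.

Theorem theorem5 (A : alg) (hA : initial E_iaz A) :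
  isomorphic A (subalg nonneg_closed).
Proof.
have [AE init] := hA; have [f hf _] := init _ nonneg_rat_sat.
exists f => //; exists (fun x => of_rat A (sval x)).
(* This round trip is an endomorphism of the initial algebra, so no induction on terms is required;
   the other one is computed directly. *)
- exact: initial_endo hA (hom_comp (of_rat_hom AE) hf).
- by move=> [q q0]; apply: val_inj; apply: hom_of_rat.
Qed.
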